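(* Let $a_{\mathrm{minBrake}},a_{\mathrm{maxBrake}},a_{\mathrm{maxAccel}},\rho,\varepsilon$ be real parameters (constants) and let $x_1,x_2,v_1,v_2,a_1,a_2,t$ be real state variables. Let $v_{1,\rho}=v_1+\rho a_{\mathrm{maxAccel}}$, $v_{2,\rho}=|v_2|+\rho a_{\mathrm{maxAccel}}$ and $$\mathrm{safeDist}(v_1,v_2)=\frac{v_1+v_{1,\rho}}{2}\rho+\frac{v_{1,\rho}^2}{2a_{\mathrm{minBrake}}}+\frac{|v_2|+v_{2,\rho}}{2}\rho+\frac{v_{2,\rho}^2}{2a_{\mathrm{minBrake}}},$$ $\mathrm{edc}\equiv v_1\ge0\wedge v_2\le0$, $$\mathrm{freeDriving}\equiv a_1:=*;\ ?(-a_{\mathrm{maxBrake}}\le a_1\le a_{\mathrm{maxAccel}});\ a_2:=*;\ ?(-a_{\mathrm{maxAccel}}\le a_2\le a_{\mathrm{maxBrake}}),$$ $$\mathrm{properResponse}\equiv\big((a_1:=*;\ ?(a_1\le -a_{\mathrm{minBrake}}))\cup(?(v_1=0);\ a_1:=0)\big);\ \big((a_2:=*;\ ?(a_2\ge a_{\mathrm{minBrake}}))\cup(?(v_2=0);\ a_2:=0)\big).$$ Write $\mathrm{ODE}(Q)$ for $\{x_1'=v_1,x_2'=v_2,v_1'=a_1,v_2'=a_2,t'=1\ \&\ Q\}$ and let $$\beta\equiv \mathrm{freeDriving};\ t:=0;\ \mathrm{ODE}(t\le\rho\wedge\mathrm{edc});\ \big(\mathrm{properResponse};\ \mathrm{ODE}(\mathrm{edc})\big)^*.$$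 Let $\mathrm{Init}\equiv x_1\le x_2\wedge 0<a_{\mathrm{minBrake}}<a_{\mathrm{maxBrake}}\wedge 0<a_{\mathrm{maxAccel}}\wedge\rho>0\wedge\mathrm{edc}\wedge\varepsilon>0\wedge \mathrm{safeDist}(v_1,v_2)-\varepsilon=x_2-x_1$. Then the formula $\mathrm{Init}\rightarrow\langle\beta\rangle(x_1>x_2)$ is valid; that is, for every state $\nu$ satisfying $\mathrm{Init}$ there exists a state $\omega$ with $(\nu,\omega)\in[\![\beta]\!]$ and $\omega(x_1)>\omega(x_2)$.
   Context: A state is a map assigning a real number to each variable. Hybrid programs denote transition relations $[\![\cdot]\!]$ on states: $(\nu,\omega)\in[\![x:=\theta]\!]$ iff $\omega$ equals $\nu$ except $\omega(x)$ is the value of $\theta$ in $\nu$; $(\nu,\omega)\in[\![x:=*]\!]$ iff $\omega$ agrees with $\nu$ except possibly at $x$ (any real value); $[\![?P]\!]=\{(\nu,\nu):\nu\models P\}$; $[\![\alpha;\beta]\!]$ is relational composition; $[\![\alpha\cup\beta]\!]=[\![\alpha]\!]\cup[\![\beta]\!]$; $[\![\alpha^*]\!]$ is the reflexive transitive closure; $(\nu,\omega)\in[\![\{x'=f(x)\ \&\ Q\}]\!]$ iff there exist $r\ge0$ and a differentiable $\varphi$ from $[0,r]$ to states with $\varphi(0)=\nu$, $\varphi(r)=\omega$, $\varphi$ solving the differential equations, all other variables constant, and $Q$ true along $\varphi$ on $[0,r]$. $\langle\alpha\rangle P$ holds in $\nu$ iff some $\omega$ with $(\nu,\omega)\in[\![\alpha]\!]$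 satisfies $P$. *)

(* Defs.v *)
(** Differential dynamic logic over the Stdlib reals, and the two-car model
    with oncoming traffic. *)
From Stdlib Require Import Reals List Relations.
Import ListNotations.
Open Scope R_scope.

Inductive var : Set := x1 | x2 | v1 | v2 | a1 | a2 | t.

Definition state : Type := var -> R.

Inductive term : Type :=
| Var (x : var)
| Const (c : R)
| Neg (e : term)
| Plus (e f : term)
| Minus (e f : term)
| Times (e f : term)
| Div (e f : term)
| Pow (e : term) (n : nat)
| Abs (e : term).

Inductive formula : Type :=
| Eq (e f : term)
| Le (e f : term)
| Lt (e f : term)
| And (P Q : formula)
| Imp (P Q : formula)
| Diamond (alpha : program) (P : formula)
with program : Type :=
| Assign (x : var) (e : term)
| AssignAny (x : var)
| Test (P : formula)
| Seq (alpha beta : program)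
| Choice (alpha beta : program)
| Loop (alpha : program)
| ODE (eqs : list (var * term)) (Q : formula).

Fixpoint eval (e : term) (nu : state) : R :=
  match e with
  | Var x => nu x
  | Const c => c
  | Neg e => - eval e nu
  | Plus e f => eval e nu + eval f nu
  | Minus e f => eval e nu - eval f nu
  | Times e f => eval e nu * eval f nu
  | Div e f => eval e nu / eval f nu
  | Pow e n => eval e nu ^ n
  | Abs e => Rabs (eval e nu)
  end.

(** In the [ODE] clause only the values of [phi] on [[0, r]] matter.  [D_in] is
    the derivative relative to [[0, r]]: one-sided at the endpoints, and no
    constraint when [r = 0]. *)
Fixpoint holds (P : formula) (nu : state) {struct P} : Prop :=
  match P with
  | Eq e f => eval e nu = eval f nu
  | Le e f => eval e nu <= eval f nu
  | Lt e f => eval e nu < eval f nu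
  | And P Q => holds P nu /\ holds Q nu
  | Imp P Q => holds P nu -> holds Q nu
  | Diamond alpha P => exists omega, sem alpha nu omega /\ holds P omega
  end
with sem (alpha : program) (nu omega : state) {struct alpha} : Prop :=
  match alpha with
  | Assign x e =>
      omega x = eval e nu /\ forall y, y <> x -> omega y = nu y
  | AssignAny x => forall y, y <> x -> omega y = nu y
  | Test P => omega = nu /\ holds P nu
  | Seq alpha beta => exists mu, sem alpha nu mu /\ sem beta mu omega
  | Choice alpha beta => sem alpha nu omega \/ sem beta nu omega
  | Loop alpha => clos_refl_trans state (sem alpha) nu omega
  | ODE eqs Q =>
      exists (r : R) (phi : R -> state),
        0 <= r /\ phi 0 = nu /\ phi r = omega /\
        forall s, 0 <= s <= r ->
          (forall x e, In (x, e) eqs ->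
             D_in (fun u => phi u x) (fun u => eval e (phi u))
                  (fun u => 0 <= u <= r) s) /\
          (forall x, ~ In x (map fst eqs) -> phi s x = nu x) /\
          holds Q (phi s)
  end.

Definition valid (P : formula) : Prop := forall nu : state, holds P nu.

Coercion Var : var >-> term.
Coercion Const : R >-> term.

Declare Scope dL_scope.
Delimit Scope dL_scope with dL.
Bind Scope dL_scope with term formula program.

Notation "- e" := (Neg e) : dL_scope.
Notation "e + f" := (Plus e f) : dL_scope.
Notation "e - f" := (Minus e f) : dL_scope.
Notation "e * f" := (Times e f) : dL_scope.
Notation "e / f" := (Div e f) : dL_scope.
Notation "e ^ n" := (Pow e n%nat) : dL_scope.
Notation "e = f" := (Eq e f) : dL_scope.
Notation "e <= f" := (Le e f) : dL_scope.
Notation "e < f" := (Lt e f) : dL_scope.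
Notation "e >= f" := (Le f e) (only parsing) : dL_scope.
Notation "e > f" := (Lt f e) (only parsing) : dL_scope.
Notation "P /\ Q" := (And P Q) : dL_scope.
Notation "P -> Q" := (Imp P Q) : dL_scope.
Notation "alpha ;; beta" := (Seq alpha beta)
  (at level 100, right associativity) : dL_scope.
Notation "alpha ∪ beta" := (Choice alpha beta)
  (at level 101, right associativity) : dL_scope.

Definition vrho1 (amaxAccel rho : R) : term := (v1 + rho * amaxAccel)%dL.

Definition vrho2 (amaxAccel rho : R) : term := (Abs v2 + rho * amaxAccel)%dL.

Definition safeDist (aminBrake amaxAccel rho : R) : term :=
  ((v1 + vrho1 amaxAccel rho) / Const 2 * rho
   + vrho1 amaxAccel rho ^ 2 / (Const 2 * aminBrake)
   + (Abs v2 + vrho2 amaxAccel rho) / Const 2 * rho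
   + vrho2 amaxAccel rho ^ 2 / (Const 2 * aminBrake))%dL.

Definition edc : formula := (v1 >= Const 0 /\ v2 <= Const 0)%dL.

Definition freeDriving (amaxBrake amaxAccel : R) : program :=
  (AssignAny a1 ;; Test (- amaxBrake <= a1 /\ a1 <= amaxAccel) ;;
   AssignAny a2 ;; Test (- amaxAccel <= a2 /\ a2 <= amaxBrake))%dL.

Definition properResponse (aminBrake : R) : program :=
  (((AssignAny a1 ;; Test (a1 <= - aminBrake))
      ∪ (Test (v1 = Const 0) ;; Assign a1 (Const 0))) ;;
   ((AssignAny a2 ;; Test (a2 >= aminBrake))
      ∪ (Test (v2 = Const 0) ;; Assign a2 (Const 0))))%dL.

Definition motion (Q : formula) : program :=
  ODE [(x1, Var v1); (x2, Var v2); (v1, Var a1); (v2, Var a2); (t, Const 1)] Q.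

Definition twoCars (aminBrake amaxBrake amaxAccel rho : R) : program :=
  (freeDriving amaxBrake amaxAccel ;;
   Assign t (Const 0) ;;
   motion (t <= rho /\ edc) ;;
   Loop (properResponse aminBrake ;; motion edc))%dL.

Definition Init (aminBrake amaxBrake amaxAccel rho eps : R) : formula :=
  (x1 <= x2
   /\ (Const 0 < aminBrake /\ aminBrake < amaxBrake)
   /\ Const 0 < amaxAccel
   /\ rho > Const 0
   /\ edc
   /\ eps > Const 0
   /\ safeDist aminBrake amaxAccel rho - eps = x2 - x1)%dL.

(* Main.v *)
(** Both cars accelerate towards each other at full rate for time [rho]; this
    uses up the first and third summands of [safeDist].  They then brake with
    exactly [aminBrake]: first until the slower one stops, then, in a second loop
    iteration, the slower one stays put until the other one stops.  The two
    braking distances are the remaining summands of [safeDist], so the final gap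
    is [- eps]. *)
Require Import Defs.
From Stdlib Require Import Reals.
From Stdlib Require Import List Relations Lra FunctionalExtensionality.

Definition with_accel (nu : state) (c1 c2 : R) : state :=
  fun y => match y with a1 => c1 | a2 => c2 | _ => nu y end.

(** Closed-form solution of the equations of [motion]: the accelerations stay constant, so
    velocities are affine and positions quadratic in time. *)
Definition flow (nu : state) (s : R) : state :=
  fun y => match y with
  | x1 => nu x1 + nu v1 * s + nu a1 * s ^ 2 / 2
  | x2 => nu x2 + nu v2 * s + nu a2 * s ^ 2 / 2
  | v1 => nu v1 + nu a1 * s
  | v2 => nu v2 + nu a2 * s
  | t => nu t + s
  | y => nu y
  end.

Lemma flow0 (nu : state) : flow nu 0 = nu.
Proof.
  apply functional_extensionality; intros []; simpl; field.
Qed.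

(** Relative to [D] the limit ranges over fewer points, so [flow] can be differentiated on the whole
    line, endpoints included. *)
Lemma D_in_derivable_pt_lim (f d : R -> R) (D : R -> Prop) (x : R) :
  derivable_pt_lim f x (d x) -> D_in f d D x.
Proof.
  intros H; apply derivable_pt_lim_D_in in H.
  apply limit1_imp with (2 := H).
  intros y [_ Hy]; split; [exact I | exact Hy].
Qed.

Lemma derivable_pt_lim_quadratic (p q c s : R) :
  derivable_pt_lim (fun u => p + q * u + c * u ^ 2 / 2) s (q + c * s).
Proof.
  intros e He.
  assert (Hc := Rabs_pos c).
  (* The error of the difference quotient is exactly [c * h / 2]; the [+ 1] keeps the radius well
     defined when [c = 0]. *)
  assert (Hd : 0 < e / (Rabs c + 1)) by (apply Rdiv_lt_0_compat; lra).
  exists (mkposreal _ Hd); simpl; intros h Hh Hhd.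
  replace (_ - _) with (c * h / 2) by (field; exact Hh).
  unfold Rdiv; rewrite !Rabs_mult, (Rabs_right (/ 2)) by lra.
  apply (Rmult_lt_compat_r (Rabs c + 1)) in Hhd; [| lra].
  unfold Rdiv in Hhd; rewrite Rmult_assoc, Rinv_l in Hhd by lra.
  assert (Hh' := Rabs_pos h).
  assert (0 <= Rabs c * Rabs h) by (apply Rmult_le_pos; assumption).
  lra.
Qed.

Lemma derivable_pt_lim_affine (p q s : R) :
  derivable_pt_lim (fun u => p + q * u) s q.
Proof.
  intros e He; exists (mkposreal _ He); intros h Hh _.
  replace (_ - _) with 0 by (field; exact Hh).
  rewrite Rabs_R0; exact He.
Qed.

Lemma sem_motion (Q : formula) (nu : state) (r : R) :
  0 <= r -> (forall s, 0 <= s <= r -> holds Q (flow nu s)) ->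
  sem (motion Q) nu (flow nu r).
Proof.
  intros Hr HQ; exists r, (flow nu).
  split; [exact Hr | split; [apply flow0 | split; [reflexivity |]]].
  intros s Hs; split; [| split; [| exact (HQ s Hs)]].
  - intros x e Hin; apply D_in_derivable_pt_lim.
    destruct Hin as [E | [E | [E | [E | [E | []]]]]];
      injection E as <- <-; simpl.
    + apply derivable_pt_lim_quadratic.
    + apply derivable_pt_lim_quadratic.
    + apply derivable_pt_lim_affine.
    + apply derivable_pt_lim_affine.
    + replace (fun u => nu t + u) with (fun u => nu t + 1 * u)
        by (apply functional_extensionality; intros; ring).
      apply derivable_pt_lim_affine.
  - intros [] Hx; simpl in Hx; try reflexivity; tauto.
Qed.

Lemma affine_nonneg (p c r s : R) :
  0 <= p -> 0 <= p + c * r -> 0 <= s <= r -> 0 <= p + c * s.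
Proof.
  intros Hp Hr [Hs Hsr]; destruct (Rle_dec 0 c) as [Hc | Hc].
  - apply Rplus_le_le_0_compat; [| apply Rmult_le_pos]; assumption.
  - assert (c * r <= c * s) by (apply Rmult_le_compat_neg_l; lra); lra.
Qed.

(** Velocities are affine in time, so their signs on [[0, r]] are controlled by the two endpoints;
    the case of [v2] is that of [- v2]. *)
Lemma edc_flow (nu : state) (r s : R) :
  holds edc nu -> holds edc (flow nu r) -> 0 <= s <= r ->
  holds edc (flow nu s).
Proof.
  simpl; intros [H1 H2] [H3 H4] Hs; split.
  - exact (affine_nonneg _ _ r s H1 H3 Hs).
  - assert (H := affine_nonneg (- nu v2) (- nu a2) r s).
    lra.
Qed.

Lemma sem_freeDriving (B A : R) (nu : state) (c1 c2 : R) :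
  - B <= c1 <= A -> - A <= c2 <= B ->
  sem (freeDriving B A) nu (with_accel nu c1 c2).
Proof.
  intros H1 H2; exists (with_accel nu c1 (nu a2)); split.
  { intros []; simpl; congruence. }
  exists (with_accel nu c1 (nu a2)); split; [split; [reflexivity | exact H1] |].
  exists (with_accel nu c1 c2); split.
  { intros []; simpl; congruence. }
  split; [reflexivity | exact H2].
Qed.

Lemma sem_properResponse (b : R) (nu : state) (c1 c2 : R) :
  c1 <= - b \/ nu v1 = 0 /\ c1 = 0 ->
  b <= c2 \/ nu v2 = 0 /\ c2 = 0 ->
  sem (properResponse b) nu (with_accel nu c1 c2).
Proof.
  intros H1 H2; exists (with_accel nu c1 (nu a2)); split.
  - destruct H1 as [H1 | [H1 ->]]; [left | right].
    + exists (with_accel nu c1 (nu a2)); split; [| split; [reflexivity | exact H1]].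
      intros []; simpl; congruence.
    + exists nu; split; [split; [reflexivity | exact H1] |].
      split; [reflexivity |]; intros []; simpl; congruence.
  - destruct H2 as [H2 | [H2 ->]]; [left | right].
    + exists (with_accel nu c1 c2); split; [| split; [reflexivity | exact H2]].
      intros []; simpl; congruence.
    + exists (with_accel nu c1 (nu a2)); split; [split; [reflexivity | exact H2] |].
      split; [reflexivity |]; intros []; simpl; congruence.
Qed.

Lemma sem_response_step (b : R) (nu : state) (c1 c2 r : R) :
  c1 <= - b \/ nu v1 = 0 /\ c1 = 0 ->
  b <= c2 \/ nu v2 = 0 /\ c2 = 0 ->
  0 <= r -> holds edc nu -> holds edc (flow (with_accel nu c1 c2) r) ->
  sem (Seq (properResponse b) (motion edc)) nu (flow (with_accel nu c1 c2) r).
Proof.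
  intros H1 H2 Hr H0 H.
  exists (with_accel nu c1 c2); split.
  - exact (sem_properResponse b nu c1 c2 H1 H2).
  - apply sem_motion; [exact Hr |].
    intros s Hs; exact (edc_flow (with_accel nu c1 c2) r s H0 H Hs).
Qed.

Lemma loop_brake_to_stop (b : R) (nu : state) :
  0 < b -> holds edc nu ->
  exists omega,
    sem (Loop (Seq (properResponse b) (motion edc))) nu omega /\
    omega x2 - omega x1 =
      nu x2 - nu x1 - nu v1 ^ 2 / (2 * b) - nu v2 ^ 2 / (2 * b).
Proof.
  intros Hb Hedc; destruct (Hedc) as [H1 H2]; simpl in H1, H2.
  destruct (Rle_dec (nu v1) (- nu v2)) as [Hle | Hgt].
  (* Car 1 is the slower one: it stops after [r1], when car 2 still has speed [- nu v2 - nu v1] and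
     needs [r2] more. For equal speeds [r2 = 0]. *)
  - set (r1 := nu v1 / b); set (r2 := (- nu v2 - nu v1) / b).
    (* In this form the velocity conditions are linear in the products [b * r1] and [b * r2], within
       reach of [lra]. *)
    assert (E1 : b * r1 = nu v1) by (unfold r1; field; lra).
    assert (E2 : b * r2 = - nu v2 - nu v1) by (unfold r2; field; lra).
    assert (0 <= r1) by (apply Rle_mult_inv_pos; lra).
    assert (0 <= r2) by (apply Rle_mult_inv_pos; lra).
    set (mu := flow (with_accel nu (- b) b) r1).
    assert (Hmu : holds edc mu) by (simpl; lra).
    exists (flow (with_accel mu 0 b) r2); split.
    + apply rt_trans with mu; apply rt_step; apply sem_response_step;
        simpl; try lra; exact Hedc || exact Hmu.
    + simpl; unfold r1, r2; field; lra.
  (* Symmetric case: car 2 stops first and then keeps acceleration 0. *)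
  - set (r1 := - nu v2 / b); set (r2 := (nu v1 + nu v2) / b).
    assert (E1 : b * r1 = - nu v2) by (unfold r1; field; lra).
    assert (E2 : b * r2 = nu v1 + nu v2) by (unfold r2; field; lra).
    assert (0 <= r1) by (apply Rle_mult_inv_pos; lra).
    assert (0 <= r2) by (apply Rle_mult_inv_pos; lra).
    set (mu := flow (with_accel nu (- b) b) r1).
    assert (Hmu : holds edc mu) by (simpl; lra).
    exists (flow (with_accel mu (- b) 0) r2); split.
    + apply rt_trans with mu; apply rt_step; apply sem_response_step;
        simpl; try lra; exact Hedc || exact Hmu.
    + simpl; unfold r1, r2; field; lra.
Qed.

Theorem theorem4 (aminBrake amaxBrake amaxAccel rho eps : R) :
  valid (Init aminBrake amaxBrake amaxAccel rho eps ->
         Diamond (twoCars aminBrake amaxBrake amaxAccel rho) (x1 > x2))%dL.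
Proof.
  intros nu (_ & (Hb & HbB) & HA & Hrho & Hedc & Heps & Hgap).
  destruct (Hedc) as [Hv1 Hv2].
  simpl in Hb, HbB, HA, Hrho, Heps, Hgap, Hv1, Hv2.
  rewrite (Rabs_left1 (nu v2)) in Hgap by exact Hv2.
  assert (HAr : 0 < amaxAccel * rho) by (apply Rmult_lt_0_compat; assumption).
  set (start := with_accel nu amaxAccel (- amaxAccel)).
  (* With the clock reset, [t] equals the elapsed time, so [t <= rho] holds along the whole flow of
     duration [rho]. *)
  set (start0 := fun y => match y with t => 0 | _ => start y end).
  set (mu := flow start0 rho).
  assert (Hmu : holds edc mu) by (simpl; lra).
  destruct (loop_brake_to_stop aminBrake mu Hb Hmu) as (omega & Hloop & Hend).
  exists omega; split.
  - exists start; split; [apply sem_freeDriving; lra |].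
    exists start0; split.
    { split; [reflexivity | intros []; simpl; congruence]. }
    exists mu; split; [| exact Hloop].
    apply sem_motion; [lra |].
    intros s Hs; split; [simpl; lra |].
    exact (edc_flow start0 rho s Hedc Hmu Hs).
  - assert (omega x2 - omega x1 = - eps).
    { rewrite Hend; simpl.
      (* Exposes the initial gap, which [Hgap] trades for the safe distance minus [eps]. Then
         everything cancels: mean speed times [rho] is the distance driven under constant
         acceleration, and the speeds at [mu] are the ones squared in the braking terms. *)
      replace (nu x2) with (nu x1 + (nu x2 - nu x1)) by ring.
      rewrite <- Hgap; field; lra. }
    simpl; lra.
Qed.
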